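(* Let $H$ be a digraph with a min-max-ordering $a_1<a_2<\dots<a_p$ of $V(H)$, and let $D$ be a digraph. Let the lists $L(x)\subseteq V(H)$, $x\in V(D)$, be obtained by the arc consistency procedure starting from $L(x)=V(H)$ for all $x$. For each $i$, let $\ell^+(i)$ be the smallest $j$ such that $a_ia_j\in A(H)$ and $\ell^-(i)$ the smallest $j$ such that $a_ja_i\in A(H)$. Consider variables $v_i$ for $v\in V(D)$ and $1\le i\le p+1$, and the system $\mathcal S$ of constraints: $v_i\ge0$; $v_1=1$; $v_{p+1}=0$; $v_{i+1}\le v_i$ for $1\le i\le p$; $v_{i+1}=v_i$ whenever $a_i\notin L(v)$; and for every arc $uv\in A(D)$ and every $i$: $u_i\le v_{\ell^+(i)}$ (for those $i$ with $\ell^+(i)$ defined) and $v_i\le u_{\ell^-(i)}$ (for those $i$ with $\ell^-(i)$ defined). Then there is a one-to-one correspondence between homomorphisms of $D$ to $H$ and integer solutions of $\mathcal S$, given by associating to a homomorphism $f$ the solution with $v_i=1$ if $i\le t$ and $v_i=0$ if $i>t$, where $f(v)=a_t$ (conversely, an integer solution corresponds to the map sending $v$ to $a_i$ for the largest $i$ with $v_i=1$).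
   Context: A digraph $H$ has finite vertex set $V(H)$ and arc set $A(H)$. A homomorphism of $D$ to $H$ is a map $f:V(D)\to V(H)$ with $f(x)f(y)\in A(H)$ for all $xy\in A(D)$. A linear ordering $<$ of $V(H)$ is a min-max-ordering if whenever $uv,u'v'\in A(H)$ with $u<u'$ and $v'<v$, both $uv'\in A(H)$ and $u'v\in A(H)$. Arc consistency procedure: repeatedly pick an arc $xy\in A(D)$; remove from $L(x)$ any $a$ having no out-neighbour in $L(y)$, and remove from $L(y)$ any $b$ having no in-neighbour in $L(x)$; stop when no further change is possible. *)

(* Defs.v *)
From HB Require Import structures.
From mathcomp Require Import all_boot all_order all_algebra.
From mathcomp Require Import classical_sets functions.
Set Implicit Arguments.
Unset Strict Implicit.
Unset Printing Implicit Defensive.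
Import Order.TTheory GRing.Theory Num.Theory.
Local Open Scope ring_scope.

Record digraph := Digraph { vertex :> finType; is_arc : rel vertex }.
Arguments is_arc {d}.

Definition is_homomorphism (D H : digraph) (f : {ffun D -> H}) : Prop :=
  forall x y : D, is_arc x y -> is_arc (f x) (f y).

Definition strict_linear_order (T : eqType) (lt : rel T) : Prop :=
  [/\ irreflexive lt, transitive lt & forall x y, x != y -> lt x y || lt y x].

Definition min_max_ordering (H : digraph) (lt : rel H) : Prop :=
  strict_linear_order lt /\
  forall u v u' v' : H, is_arc u v -> is_arc u' v' -> lt u u' -> lt v' v ->
    is_arc u v' /\ is_arc u' v.

Section ArcConsistency.
Variables D H : digraph.

Definition lists := {ffun D -> {set H}}.

Definition prune_tail (x y : D) (L : lists) : lists :=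
  [ffun z => if z == x then [set b in L x | [exists c in L y, is_arc b c]]
             else L z].

Definition prune_head (x y : D) (L : lists) : lists :=
  [ffun z => if z == y then [set c in L y | [exists b in L x, is_arc b c]]
             else L z].

Definition revise (x y : D) (L : lists) : lists :=
  prune_head x y (prune_tail x y L).

Inductive ac_reachable : lists -> Prop :=
| ac_start : ac_reachable [ffun=> [set: H]]
| ac_step L x y : ac_reachable L -> is_arc x y -> ac_reachable (revise x y L).

(* The order in which arcs are picked is left free: [ac_output L] says that
   some run of the procedure stops with the lists [L]. *)
Definition ac_output (L : lists) : Prop :=
  ac_reachable L /\ forall x y : D, is_arc x y -> revise x y L = L.

End ArcConsistency.

(* Indices are shifted down by one: a_i (1 <= i <= p) is [tnth a] at the ordinal
   i - 1 : 'I_p, and v_i (1 <= i <= p+1) is [x v] at the ordinal i - 1 : 'I_p.+1.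
   So, for i : 'I_p, v_i and v_{i+1} are the two expressions below. *)
Notation var_at x v i := (x v (widen_ord (leqnSn _) i)).
Notation var_next x v i := (x v (lift ord0 i)).

Section System.
Variables (D H : digraph) (p : nat) (a : p.-tuple H).

(* [None] when a_i has no out-neighbour, resp. no in-neighbour. *)
Definition ell_plus (i : 'I_p) : option 'I_p :=
  [pick j | is_arc (tnth a i) (tnth a j)
          & [forall k : 'I_p, is_arc (tnth a i) (tnth a k) ==> (j <= k)%N]].

Definition ell_minus (i : 'I_p) : option 'I_p :=
  [pick j | is_arc (tnth a j) (tnth a i)
          & [forall k : 'I_p, is_arc (tnth a k) (tnth a i) ==> (j <= k)%N]].

Definition assignment (R : Type) := {ffun D -> {ffun 'I_p.+1 -> R}}.

Record is_solution (R : numDomainType) (L : lists D H) (x : assignment R)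
    : Prop := IsSolution {
  sol_ge0 : forall v i, 0 <= x v i;
  sol_first : forall v, x v ord0 = 1;
  sol_last : forall v, x v ord_max = 0;
  sol_monotone : forall v (i : 'I_p), var_next x v i <= var_at x v i;
  sol_list : forall v (i : 'I_p),
    tnth a i \notin L v -> var_next x v i = var_at x v i;
  sol_plus : forall u v (i j : 'I_p),
    is_arc u v -> ell_plus i = Some j -> var_at x u i <= var_at x v j;
  sol_minus : forall u v (i j : 'I_p),
    is_arc u v -> ell_minus i = Some j -> var_at x v i <= var_at x u j
}.

(* [index (f v) a] is the 0-based t with f v = a_t. *)
Definition hom_assignment (f : {ffun D -> H}) : assignment int :=
  [ffun v => [ffun i : 'I_p.+1 => if (i <= index (f v) a)%N then 1 else 0]].

End System.

Definition homomorphisms (D H : digraph) : set {ffun D -> H} :=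
  @is_homomorphism D H.
Arguments homomorphisms : clear implicits.

Definition integer_solutions (D H : digraph) (p : nat) (a : p.-tuple H)
    (L : lists D H) : set (assignment D p int) :=
  is_solution a L.

(* Main.v *)
(** Identify the vertices of [H] with their indices in the ordering. Along an
    integer solution the values [v_1, ..., v_{p+1}] descend from 1 to 0, so they
    form a step function, and solutions are the same thing as threshold maps
    [v |-> t(v)] subject to the remaining constraints. Equality on
    non-list vertices says exactly that the threshold of [v] lies in [L(v)],
    which holds for homomorphisms because arc consistency never discards a value
    taken by a homomorphism. For an arc [uv] of [D] with thresholds [t], [s], the
    arc constraints give [l^+(t) <= s] and [l^-(s) <= t]; the min-max property
    applied to the arcs [(t, l^+(t))] and [(l^-(s), s)] yields the arc [(t, s)].
    Conversely, if [(t, s)] is an arc and [i <= t], the min-max property applied to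
    [(i, l^+(i))] and [(t, s)] forces [l^+(i) <= s]. *)
Require Import Defs.
From mathcomp Require Import all_boot all_order all_algebra.
From mathcomp Require Import classical_sets functions.
Set Implicit Arguments.
Unset Strict Implicit.
Unset Printing Implicit Defensive.
Import Order.TTheory GRing.Theory Num.Theory.
Local Open Scope ring_scope.

Section PickMin.
Variables (p : nat) (P : pred 'I_p).

(** Common shape of [ell_plus] and [ell_minus], with [P] selecting the out-neighbours or the
    in-neighbours of a fixed vertex. *)
Let first := [pick j | P j & [forall k : 'I_p, P k ==> (j <= k)%N]].

Lemma pick_min_some (j : 'I_p) :
  first = Some j -> P j /\ forall k : 'I_p, P k -> (j <= k)%N.
Proof.
rewrite /first; case: pickP => // j' /andP[Pj /forallP minj] [<-].
by split=> // k Pk; apply: (implyP (minj k)).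
Qed.

Lemma pick_min_ex (k : 'I_p) : P k -> exists j, first = Some j.
Proof.
rewrite /first => Pk; case: pickP => [j _|none]; first by exists j.
have [j Pj minj] := arg_minnP (fun i : 'I_p => nat_of_ord i) Pk.
have /= := none j; rewrite Pj /= => /forallP[] i.
by apply/implyP => /minj.
Qed.

End PickMin.

Section StepFunction.
Variables (p : nat) (y : {ffun 'I_p.+1 -> int}).
Hypothesis y_mono :
  forall i : 'I_p, y (lift ord0 i) <= y (widen_ord (leqnSn _) i).

Lemma step_antitone (i j : 'I_p.+1) : (i <= j)%N -> y j <= y i.
Proof.
have [m] := ubnP j; elim: m i j => // m IHm i j ltjm leij.
case: (unliftP ord0 j) => [j' jE|jE]; rewrite {}jE in ltjm leij *; last first.
  by rewrite (@ord_inj _ i ord0) //; apply/eqP; rewrite -leqn0.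
move: leij; rewrite leq_eqVlt => /predU1P[/ord_inj->//|].
rewrite lift0 ltnS => leij; rewrite lift0 in ltjm.
exact: le_trans (y_mono j') (IHm _ (widen_ord (leqnSn p) j') ltjm leij).
Qed.

(** The threshold is the last index with value 1; it is not the final index, where the value is 0.
    Beyond it, integrality leaves only 0 in the range from 0 to 1. *)
Lemma step_threshold :
    (forall i, 0 <= y i) -> y ord0 = 1 -> y ord_max = 0 ->
  exists t : 'I_p, forall k, y k = if (k <= t)%N then 1 else 0.
Proof.
move=> y_ge0 y0 yp.
have y0b : [pred i | y i == 1] ord0 by rewrite /= y0.
have [t /eqP yt maxt] := arg_maxnP (fun i : 'I_p.+1 => nat_of_ord i) y0b.
have ltp : (t < p)%N.
  rewrite ltn_neqAle -ltnS ltn_ord andbT; apply/eqP => tp.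
  by move: yt; rewrite (_ : t = ord_max) ?yp //; apply: ord_inj.
exists (Ordinal ltp) => k /=.
have yk1 : y k <= 1 by rewrite -y0 step_antitone.
have [lekt|ltkt] := leqP k t.
  by apply/eqP; rewrite eq_le yk1 -yt step_antitone.
have : y k != 1 by apply: contraTneq ltkt => /eqP/maxt; rewrite -leqNgt.
by have := y_ge0 k; case: (y k) yk1 => [[|[|n]]|n].
Qed.

End StepFunction.

Section ArcConsistencyTheory.
Variables D H : digraph.
Implicit Type L : lists D H.

(** Along an arc [x y], the values [f x] and [f y] support each other, so no revision can discard
    either. *)
Lemma ac_reachable_hom L (f : {ffun D -> H}) :
  ac_reachable L -> is_homomorphism f -> forall v, f v \in L v.
Proof.
move=> reachL homf; elim: reachL => [v|{}L x y _ IHL xy]; first by rewrite ffunE inE.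
have tailL v : f v \in prune_tail x y L v.
  rewrite ffunE; case: eqP => [->|_]; last exact: IHL.
  by rewrite inE IHL; apply/existsP; exists (f y); rewrite IHL homf.
move=> v; rewrite /revise ffunE; case: eqP => [->|_]; last exact: tailL.
by rewrite inE tailL; apply/existsP; exists (f x); rewrite tailL homf.
Qed.

Lemma prune_tail_sub L x y v : prune_tail x y L v \subset L v.
Proof.
by rewrite ffunE; case: eqP => [->|//]; apply/fintype.subsetP => b; rewrite inE => /andP[].
Qed.

Lemma prune_head_sub L x y v : prune_head x y L v \subset L v.
Proof.
by rewrite ffunE; case: eqP => [->|//]; apply/fintype.subsetP => b; rewrite inE => /andP[].
Qed.

(** Only the composite of the two prunings is known to fix [L]; as head pruning merely shrinks
    lists, [b] must already have survived tail pruning. *)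
Lemma revise_fix_out L x y b :
  revise x y L = L -> b \in L x -> exists2 c, c \in L y & is_arc b c.
Proof.
move=> fixL; rewrite -{1}fixL => /(fintype.subsetP (prune_head_sub _ _ _ _)).
by rewrite ffunE eqxx inE => /andP[_ /existsP[c /andP[]]]; exists c.
Qed.

Lemma revise_fix_in L x y c :
  revise x y L = L -> c \in L y -> exists2 b, b \in L x & is_arc b c.
Proof.
move=> fixL; rewrite -{1}fixL ffunE eqxx inE => /andP[_ /existsP[b /andP[bL bc]]].
by exists b => //; apply: fintype.subsetP bL; apply: prune_tail_sub.
Qed.

End ArcConsistencyTheory.

Section Correspondence.
Variables (D H : digraph) (lt : rel H) (p : nat) (a : p.-tuple H).
Hypotheses (lt_mm : min_max_ordering lt) (a_all : forall w : H, w \in a).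
Hypothesis a_sorted : sorted lt a.
Implicit Types (f : {ffun D -> H}) (L : lists D H).

Lemma lt_tnth (i j : 'I_p) : (i < j)%N -> lt (tnth a i) (tnth a j).
Proof.
case: lt_mm => [[_ lt_tr _] _]; have x0 := tnth a i.
rewrite !(tnth_nth x0) => ltij.
by apply: (sorted_ltn_nth lt_tr) => //; rewrite inE size_tuple.
Qed.

Lemma index_tnth (i : 'I_p) : index (tnth a i) a = i.
Proof.
case: lt_mm => [[lt_irr lt_tr _] _]; rewrite (tnth_nth (tnth a i)).
by rewrite index_uniq ?size_tuple // (sorted_uniq lt_tr lt_irr).
Qed.

Lemma index_lt (w : H) : (index w a < p)%N.
Proof. by rewrite -[X in (_ < X)%N](size_tuple a) index_mem. Qed.

Lemma tnth_index w (i : 'I_p) : index w a = i -> w = tnth a i.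
Proof. by rewrite (tnth_nth w) => <-; rewrite nth_index. Qed.

(** Weak inequalities are allowed because, when either one is an equality, the two arcs obtained are
    the two given ones. *)
Lemma min_max_tnth (i j i' j' : 'I_p) :
    is_arc (tnth a i) (tnth a j) -> is_arc (tnth a i') (tnth a j') ->
    (i <= i')%N -> (j' <= j)%N ->
  is_arc (tnth a i) (tnth a j') /\ is_arc (tnth a i') (tnth a j).
Proof.
case: lt_mm => _ mm ij ij'.
rewrite leq_eqVlt => /predU1P[/ord_inj eqi|lti]; first by rewrite eqi in ij *.
rewrite leq_eqVlt => /predU1P[/ord_inj eqj|ltj]; first by rewrite eqj in ij' *.
by apply: mm ij ij' _ _; apply: lt_tnth.
Qed.

Lemma hom_assignment_inj f g : hom_assignment a f = hom_assignment a g -> f = g.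
Proof.
move=> eqfg; apply/ffunP => v.
have leq_fg i : (i < p)%N -> (i <= index (f v) a)%N = (i <= index (g v) a)%N.
  move=> /ltnW lti; have /ffunP/(_ v)/ffunP/(_ (Ordinal (lti : (i < p.+1)%N))) := eqfg.
  by rewrite !ffunE /=; do 2!case: leq.
apply: (index_inj (f v) (s := a)) => //.
(* Evaluate the agreement at the threshold of [f], then at that of [g]. *)
apply/eqP; rewrite eqn_leq -leq_fg ?index_lt // leqnn /=.
by rewrite leq_fg ?index_lt.
Qed.

Lemma hom_assignment_solution L f :
  ac_reachable L -> is_homomorphism f -> is_solution a L (hom_assignment a f).
Proof.
move=> reachL homf; have fL := ac_reachable_hom reachL homf.
have arc_f u v (t := Ordinal (index_lt (f u))) (s := Ordinal (index_lt (f v))) :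
    is_arc u v -> is_arc (tnth a t) (tnth a s).
  by move=> /homf; rewrite (@tnth_index (f u) t) // (@tnth_index (f v) s).
split=> [v i|v|v|v i|v i|u v i j uv|u v i j uv].
- by rewrite !ffunE; case: ifP.
- by rewrite !ffunE.
- by rewrite !ffunE leqNgt index_lt.
- by rewrite !ffunE lift0 /=; have [/ltnW->|_] := ltnP i; last case: ifP.
(* The step function drops only just after [index (f v) a], and that vertex is in the list. *)
- rewrite !ffunE lift0 /= => iL; suff ne : i != index (f v) a :> nat.
    by rewrite ltn_neqAle ne.
  by apply: contraNneq iL => /esym/tnth_index<-.
- case/pick_min_some => ij minj; rewrite !ffunE /=.
  have [leit|_] := leqP i; last by case: ifP.
  have [//|ltsj] := leqP j.
  have [arc_is _] := min_max_tnth ij (arc_f _ _ uv) leit (ltnW ltsj).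
  by have := minj _ arc_is; rewrite leqNgt ltsj.
- case/pick_min_some => ji minj; rewrite !ffunE /=.
  have [leis|_] := leqP i; last by case: ifP.
  have [//|lttj] := leqP j.
  (* An in-neighbour [t] of [i] with [t < j] would contradict the minimality of [j]. *)
  have [ti _] := min_max_tnth (arc_f _ _ uv) ji (ltnW lttj) leis.
  by have := minj _ ti; rewrite leqNgt lttj.
Qed.

Lemma solution_hom L (x : assignment D p int) :
    ac_output L -> is_solution a L x ->
  exists f, [/\ is_homomorphism f, hom_assignment a f = x
    & forall v, exists i : 'I_p,
        [/\ var_at x v i = 1,
            forall k : 'I_p.+1, x v k = 1 -> (k <= i)%N
          & f v = tnth a i]].
Proof.
move=> [_ fixL] [x_ge0 x_first x_last x_mono x_list x_plus x_minus].
have /fin_all_exists[t xE] v :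
    exists t : 'I_p, forall k, x v k = if (k <= t)%N then 1 else 0.
  exact: step_threshold.
(* Otherwise the list constraint would equate the values 1 and 0 on either side of the drop. *)
have tL v : tnth a (t v) \in L v.
  have [//|/x_list] := boolP (tnth a (t v) \in L v).
  by rewrite !xE lift0 /= ltnn leqnn.
exists [ffun v => tnth a (t v)]; split.
- move=> u v uv; rewrite !ffunE.
  (* List membership serves here to make [ell_plus] and [ell_minus] defined at the two
     thresholds. *)
  have [c _ tc] := revise_fix_out (fixL _ _ uv) (tL u).
  have [b _ bs] := revise_fix_in (fixL _ _ uv) (tL v).
  have [k0 ck0] := tnthP _ _ (a_all c); have [k1 bk1] := tnthP _ _ (a_all b).
  rewrite {}ck0 in tc; rewrite {}bk1 in bs.
  have [j jE] : exists j, ell_plus a (t u) = Some j by apply: pick_min_ex tc.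
  have [i iE] : exists i, ell_minus a (t v) = Some i.
    by apply: (pick_min_ex (P := fun k => is_arc (tnth a k) _)) bs.
  (* At the threshold of [u] the left side of the constraint is 1, which forces the right side to be
     1. *)
  have lejs : (j <= t v)%N.
    by have := x_plus _ _ _ _ uv jE; rewrite !xE /= leqnn; case: ifP.
  have leit : (i <= t u)%N.
    by have := x_minus _ _ _ _ uv iE; rewrite !xE /= leqnn; case: ifP.
  have [tj _] := pick_min_some jE.
  have [arc_is _] := pick_min_some (P := fun k => is_arc (tnth a k) _) iE.
  by have [] := min_max_tnth arc_is tj leit lejs.
- by apply/ffunP => v; apply/ffunP => k; rewrite !ffunE index_tnth xE.
- move=> v; exists (t v); split; last by rewrite ffunE.
    by rewrite xE /= leqnn.
  by move=> k; rewrite xE; case: ifP.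
Qed.

End Correspondence.

Theorem theorem5 (D H : digraph) (lt : rel H) (p : nat) (a : p.-tuple H)
    (L : lists D H) :
  min_max_ordering lt ->
  (forall w : H, w \in a) -> sorted lt a ->
  ac_output L ->
  set_bij (homomorphisms D H) (integer_solutions a L)
    (fun f : {ffun D -> H} => hom_assignment a f) /\
  (forall x : assignment D p int, integer_solutions a L x ->
     exists f : {ffun D -> H},
       [/\ homomorphisms D H f,
           hom_assignment a f = x
         & forall v : D, exists i : 'I_p,
             [/\ var_at x v i = 1,
                 forall k : 'I_p.+1, x v k = 1 -> (k <= i)%N
               & f v = tnth a i]]).
Proof.
move=> lt_mm a_all a_sorted acL.
have sol_hom := solution_hom lt_mm a_all a_sorted acL.
split; last exact: sol_hom.
split.
- by move=> f homf; apply: (hom_assignment_solution lt_mm) => //; case: acL.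
- by move=> f g _ _; apply: hom_assignment_inj.
- by move=> x /sol_hom[f [homf fx _]]; exists f.
Qed.
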